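(* Let $(y(t),\delta(t))$ be a solution of the constrained joint dynamics $$\frac{dy}{dt}=-\alpha\,P_{\mathcal{Q}}\bigl(\delta^T\delta\,x\bigr),\qquad \frac{d\delta}{dt}=-\beta\,\Pi_{\mathcal{M}}\bigl(\delta\,x\,x^T\bigr),\qquad x=\tilde u+\tilde y,\quad \alpha,\beta>0,$$ with initial conditions $(y_0,\delta_0)$. 1. The total disagreement energy $\Psi(y,\delta)=\frac12\|\delta x\|^2$ is nonincreasing along trajectories. 2. The Frobenius norm $\|\delta\|_F$ is nonincreasing along trajectories (i.e. along every solution, for all stubborn configurations $u$ and initial conditions) if and only if every edge is Type S (equivalently, $E_A=\varnothing$). 3. If the forward orbit $\{(y(t),\delta(t)):t\ge0\}$ is precompact, then the trajectory converges to the set of equilibria.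
   Context: Let $G=(V,E)$ be a finite connected graph. A discourse sheaf $\mathcal{F}$ on $G$ assigns finite-dimensional real inner product spaces $\mathcal{F}(v)$, $\mathcal{F}(e)$ to vertices and edges and linear restriction maps $\mathcal{F}_{v\unlhd e}:\mathcal{F}(v)\to\mathcal{F}(e)$ to incidences $v\in e$ (written $v\unlhd e$). $C^0=\bigoplus_v\mathcal{F}(v)$, $C^1=\bigoplus_e\mathcal{F}(e)$ with direct-sum inner products. For a fixed edge orientation the coboundary is $(\delta x)_e=\mathcal{F}_{v\unlhd e}(x_v)-\mathcal{F}_{u\unlhd e}(x_u)$ for $e=u\to v$. In the joint dynamics the stalks are fixed, but the restriction maps, encoded by the blocks of $\delta$ (the block $\delta_{v\unlhd e}:\mathcal{F}(v)\to\mathcal{F}(e)$ is $\pm\mathcal{F}_{v\unlhd e}$, and blocks for non-incident pairs are zero), vary with time. Stubborn opinions: $U\subseteq V$ is the set of stubborn vertices; each stalk splits orthogonally as $\mathcal{F}(v)=S_v\oplus T_v$ with $T_v=S_v^\perp$ and $S_v=\{0\}$ for $v\notin U$. $C^0(S)=\bigoplus_vS_v$, $C^0(\mathcal{Q})=\bigoplus_vT_v$; $P_{\mathcal{Q}}:C^0\to C^0(\mathcal{Q})$ is the orthogonal projection. $u\in C^0(S)$ is fixed (constant in time), $y(t)\in C^0(\mathcal{Q})$ evolves, and $\tilde u,\tilde y$ denote their inclusions in $C^0$. Adapting incidences: $\mathcal{I}\subseteq\{(v,e):v\unlhd e\}$. $\mathcal{M}$ is the space of structure velocities leaving non-adapting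 maps unchanged, i.e. linear maps $C^0\to C^1$ whose block from $\mathcal{F}(v)$ to $\mathcal{F}(e)$ vanishes unless $(v,e)\in\mathcal{I}$; $\Pi_{\mathcal{M}}$ is the orthogonal projection onto $\mathcal{M}$ in the Frobenius inner product. $\delta xx^T$ denotes the rank-one map $z\mapsto\langle x,z\rangle\,\delta x$. An edge $e=\{u,v\}$ is Type S (symmetric) if either both $(u,e),(v,e)\in\mathcal{I}$ or both $(u,e),(v,e)\notin\mathcal{I}$; it is Type A (asymmetric) if exactly one of them is in $\mathcal{I}$. $E_S$, $E_A$ are the sets of Type S, Type A edges. An equilibrium is a stationary point of the dynamics.
   Formalization: In part 2 the equivalence is stated assuming that every Type A edge has a nonzero edge stalk and nonzero stalks at both endpoints; with zero stalks the ''only if'' fails (e.g. one Type A edge with zero edge stalk has constant norm 0). *)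

(* Defs.v *)
From HB Require Import structures.
From mathcomp Require Import all_boot all_order all_algebra.
From mathcomp Require Import all_classical all_reals all_analysis.

Set Implicit Arguments.
Unset Strict Implicit.
Unset Printing Implicit Defensive.

Import Order.TTheory GRing.Theory Num.Theory.
Import numFieldNormedType.Exports.

Local Open Scope classical_set_scope.
Local Open Scope ring_scope.

(* A finite connected simple graph on the vertices 'I_n with edges 'I_m, each
   edge carrying the fixed orientation src e -> tgt e. *)
Record graph (n m : nat) := Graph {
  src : 'I_m -> 'I_n;
  tgt : 'I_m -> 'I_n;
  loopless : forall e, src e != tgt e;
  no_parallel_edges : injective (fun e => [set src e; tgt e]%SET);
  graph_connected : forall v w, connect [rel a b | [exists e,
        ((src e == a) && (tgt e == b)) || ((src e == b) && (tgt e == a))]] v w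
}.

Definition incident n m (G : graph n m) (v : 'I_n) (e : 'I_m) : bool :=
  (v == src G e) || (v == tgt G e).

Definition incidences n m (G : graph n m) : {set 'I_n * 'I_m} :=
  [set ve | incident G ve.1 ve.2]%SET.

Definition type_S n m (G : graph n m) (I : {set 'I_n * 'I_m}) : {set 'I_m} :=
  [set e | ((src G e, e) \in I) && ((tgt G e, e) \in I) ||
           ((src G e, e) \notin I) && ((tgt G e, e) \notin I)]%SET.

Definition type_A n m (G : graph n m) (I : {set 'I_n * 'I_m}) : {set 'I_m} :=
  [set e | ((src G e, e) \in I) (+) ((tgt G e, e) \in I)]%SET.

Section Frobenius.
Variables (R : realType) (m n : nat).

(* The Frobenius inner product; on column vectors it is the Euclidean one. *)
Definition mxdot (A B : 'M[R]_(m, n)) : R := \tr (A^T *m B).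

Definition frobenius_norm (A : 'M[R]_(m, n)) : R := Num.sqrt (mxdot A A).

(* Such a P exists and is unique when W is a linear subspace. *)
Definition orth_proj (W : set 'M[R]_(m, n)) (A : 'M[R]_(m, n)) : 'M[R]_(m, n) :=
  xget 0 [set P | W P /\ forall B, W B -> mxdot (A - P) B = 0].

End Frobenius.

Definition nonincreasing_nonneg (R : realType) (f : R -> R) : Prop :=
  forall s t : R, 0 <= s -> s <= t -> f t <= f s.

Section JointDynamics.
Variables (R : realType) (n m : nat) (G : graph n m).

(* The stalks F(v) and F(e), written in orthonormal coordinates, are
   'cV[R]_(dV v) and 'cV[R]_(dE e) with the Euclidean inner product. *)
Variables (dV : 'I_n -> nat) (dE : 'I_m -> nat).

Local Notation cochain0 := 'cV[R]_(\sum_(v < n) dV v).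
Local Notation structure := 'M[R]_(\sum_(e < m) dE e, \sum_(v < n) dV v).

(* rho e v is the restriction map F(v) -> F(e); its values at non-incident pairs
   are not used. *)
Definition coboundary (rho : forall e v, 'M[R]_(dE e, dV v)) : structure :=
  \mxblock_(e < m, v < n)
    (if v == tgt G e then rho e v else if v == src G e then - rho e v else 0).

Definition is_coboundary (d : structure) : Prop :=
  exists rho, d = coboundary rho.

Variable S : forall v, {vspace 'cV[R]_(dV v)}.

Definition C0_S : set cochain0 :=
  [set x | forall v, submxcol x v \in S v].

(* The condition on each block is membership in T_v, the orthogonal complement
   of S_v. *)
Definition C0_Q : set cochain0 :=
  [set x | forall v s, s \in S v -> mxdot s (submxcol x v) = 0].

Variable I : {set 'I_n * 'I_m}.

Definition structure_velocities : set structure :=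
  [set A | forall e v, (v, e) \notin I -> submxblock A e v = 0].

Variables alpha beta : R.
Variable u : cochain0.

Definition opinion_velocity (y : cochain0) (d : structure) : cochain0 :=
  - alpha *: orth_proj C0_Q (d^T *m d *m (u + y)).

Definition structure_velocity (y : cochain0) (d : structure) : structure :=
  - beta *: orth_proj structure_velocities (d *m (u + y) *m (u + y)^T).

(* A solution on [0, +oo[; values at negative times are irrelevant. Requiring
   the equations for t > 0 together with continuity on [0, +oo[ amounts to
   requiring them for t >= 0 with a right derivative at 0, since the right-hand
   sides are continuous in (y, d). *)
Record solution (y : R -> cochain0) (d : R -> structure) : Prop := Solution {
  sol_opinion_space : forall t : R, 0 <= t -> C0_Q (y t);
  sol_structure_space : forall t : R, 0 <= t -> is_coboundary (d t);
  sol_opinion_cont : {within `[0, +oo[, continuous y};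
  sol_structure_cont : {within `[0, +oo[, continuous d};
  sol_opinion_ode : forall t : R, 0 < t ->
    is_derive t (1 : R) y (opinion_velocity (y t) (d t));
  sol_structure_ode : forall t : R, 0 < t ->
    is_derive t (1 : R) d (structure_velocity (y t) (d t))
}.

Definition disagreement (y : cochain0) (d : structure) : R :=
  2^-1 * frobenius_norm (d *m (u + y)) ^+ 2.

Definition equilibria : set (cochain0 * structure) :=
  [set p | [/\ C0_Q p.1, is_coboundary p.2,
               opinion_velocity p.1 p.2 = 0 & structure_velocity p.1 p.2 = 0]].

Definition forward_orbit (y : R -> cochain0) (d : R -> structure) :
    set (cochain0 * structure) :=
  [set (y t, d t) | t in `[0, +oo[].

Definition converges_to_set (y : R -> cochain0) (d : R -> structure)
    (A : set (cochain0 * structure)) : Prop :=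
  forall eps : R, 0 < eps ->
    \forall t \near +oo, exists2 p, A p & `|(y t, d t) - p| < eps.

End JointDynamics.

(* Main.v *)
Require Import Defs.
From HB Require Import structures.
From mathcomp Require Import all_boot all_order all_algebra.
From mathcomp Require Import all_classical all_reals all_analysis.
From mathcomp Require Import ring lra.

Set Implicit Arguments.
Unset Strict Implicit.
Unset Printing Implicit Defensive.

Import Order.TTheory GRing.Theory Num.Theory.
Import numFieldNormedType.Exports.

Local Open Scope classical_set_scope.
Local Open Scope ring_scope.

(** Write x = u + y, g for the projection of delta^T delta x on the space C0_Q
    of admissible opinion velocities, and h for the projection of delta x x^T on
    the space M of admissible structure velocities.  Orthogonal projections are
    self-adjoint and idempotent, so differentiating the energy
    Psi = 1/2 |delta x|^2 along a solution gives the dissipation identity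

      Psi' = - (alpha |g|^2 + beta |h|^2)            [disagreement_derive],

    which makes Psi nonincreasing, and whose right-hand side vanishes exactly at
    the equilibria.

    Norm of delta, all edges of Type S: delta differs from its part delta_I on
    adapting incidences by something orthogonal to M, so
    <delta, h> = <delta_I, delta x x^T> = <delta_I x, delta x>.  The edge
    component (delta_I x)_e is (delta x)_e if both ends of e adapt and 0 if
    neither does; hence this is a sum of squares and |delta|^2 decreases
    [type_S_alignment].

    Norm of delta, some edge e of Type A: let a be its adapting end and b the
    other one.  Take unit vectors Xa, Xb, Y in the stalks of a, b, e, with each
    of Xa, Xb either entirely stubborn or entirely free.  The ansatz
    x = s Xa + r Xb, delta = p Y Xa^T + Y Xb^T is preserved by the dynamics and
    reduces it to scalar equations for s, p, r whose velocities are all multiples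
    of the disagreement w = p s + r.  After the time change theta' = - w these
    equations become linear in theta and are solved by exponentials and affine
    functions [growth_profile]; what remains is one scalar autonomous equation
    for theta, whose solution is global because w vanishes, with bounded slope,
    at the rest point theta = 0 [scalar_flow].  Starting at theta = -1 the
    parameter theta increases, therefore so do p >= 0 and
    |delta|^2 = p^2 + 1 [one_edge_growth].

    Convergence: on a precompact orbit the velocities are bounded, so the
    trajectory is Lipschitz.  If it came back for ever to a point with positive
    dissipation it would, at each late visit, stay near it for a fixed time and
    lose a fixed amount of Psi, while Psi is nonincreasing and bounded below
    [recurrent_dissipation_eq0].  So every cluster point of the trajectory is an
    equilibrium, and compactness turns this into convergence to the set of
    equilibria. *)

(** * The Frobenius inner product *)

Section FrobeniusProduct.
Variable R : realType.

Lemma mxdotE m n (A B : 'M[R]_(m, n)) :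
  mxdot A B = \sum_i \sum_j A i j * B i j.
Proof.
rewrite /mxdot /mxtrace exchange_big /=; apply: eq_bigr => j _.
by rewrite mxE; apply: eq_bigr => i _; rewrite mxE.
Qed.

Lemma mxdotC m n (A B : 'M[R]_(m, n)) : mxdot A B = mxdot B A.
Proof.
by rewrite !mxdotE; apply: eq_bigr => i _; apply: eq_bigr => j _; rewrite mulrC.
Qed.

Lemma mxdotDl m n (A B C : 'M[R]_(m, n)) :
  mxdot (A + B) C = mxdot A C + mxdot B C.
Proof. by rewrite /mxdot linearD mulmxDl mxtraceD. Qed.

Lemma mxdotZl m n a (A C : 'M[R]_(m, n)) : mxdot (a *: A) C = a * mxdot A C.
Proof. by rewrite /mxdot linearZ -scalemxAl mxtraceZ. Qed.

Lemma mxdotDr m n (A B C : 'M[R]_(m, n)) :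
  mxdot C (A + B) = mxdot C A + mxdot C B.
Proof. by rewrite mxdotC mxdotDl !(mxdotC C). Qed.

Lemma mxdotZr m n a (A C : 'M[R]_(m, n)) : mxdot C (a *: A) = a * mxdot C A.
Proof. by rewrite mxdotC mxdotZl (mxdotC C). Qed.

Lemma mxdotNl m n (A C : 'M[R]_(m, n)) : mxdot (- A) C = - mxdot A C.
Proof. by rewrite -scaleN1r mxdotZl mulN1r. Qed.

Lemma mxdotBl m n (A B C : 'M[R]_(m, n)) :
  mxdot (A - B) C = mxdot A C - mxdot B C.
Proof. by rewrite mxdotDl mxdotNl. Qed.

Lemma mxdot0l m n (A : 'M[R]_(m, n)) : mxdot 0 A = 0.
Proof. by rewrite -(scale0r A) mxdotZl mul0r. Qed.

Lemma mxdot0r m n (A : 'M[R]_(m, n)) : mxdot A 0 = 0.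
Proof. by rewrite mxdotC mxdot0l. Qed.

Lemma mxdot_ge0 m n (A : 'M[R]_(m, n)) : 0 <= mxdot A A.
Proof.
by rewrite mxdotE; apply: sumr_ge0 => i _; apply: sumr_ge0 => j _;
   rewrite -expr2 sqr_ge0.
Qed.

Lemma mxdot_eq0 m n (A : 'M[R]_(m, n)) : (mxdot A A == 0) = (A == 0).
Proof.
apply/eqP/eqP => [|->]; last exact: mxdot0l.
rewrite mxdotE => /eqP; rewrite psumr_eq0; last first.
  by move=> i _; apply: sumr_ge0 => j _; rewrite -expr2 sqr_ge0.
move=> /allP A0; apply/matrixP => i j; rewrite mxE.
have := A0 i; rewrite mem_index_enum => /(_ isT) /=.
rewrite psumr_eq0; last by move=> k _; rewrite -expr2 sqr_ge0.
move=> /allP /(_ j); rewrite mem_index_enum => /(_ isT) /=.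
by rewrite mulf_eq0 orbb => /eqP.
Qed.

Lemma mxdot_mull m n p (A : 'M[R]_(m, n)) (B : 'M[R]_(n, p)) C :
  mxdot (A *m B) C = mxdot B (A^T *m C).
Proof. by rewrite /mxdot trmx_mul mulmxA. Qed.

Lemma mxdot_mulr m n p (A : 'M[R]_(m, n)) (B : 'M[R]_(n, p)) C :
  mxdot (A *m B) C = mxdot A (C *m B^T).
Proof. by rewrite /mxdot trmx_mul -!mulmxA mxtrace_mulC !mulmxA. Qed.

Lemma mulmx_dot m (A B : 'cV[R]_m) : A^T *m B = (mxdot A B)%:M.
Proof. by rewrite [LHS]mx11_scalar /mxdot /mxtrace big_ord1. Qed.

Lemma mxdot_rank1 m n (A C : 'cV[R]_m) (B D : 'cV[R]_n) :
  mxdot (A *m B^T) (C *m D^T) = mxdot A C * mxdot B D.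
Proof.
rewrite mxdot_mulr trmxK -mulmxA mulmx_dot mul_mx_scalar mxdotZr.
by rewrite (mxdotC D) mulrC.
Qed.

Lemma frobenius_norm_sqr m n (A : 'M[R]_(m, n)) :
  frobenius_norm A ^+ 2 = mxdot A A.
Proof. by rewrite sqr_sqrtr // mxdot_ge0. Qed.

Lemma mxdot_mxcol k (p : 'I_k -> nat) n (A B : 'M[R]_(\sum_i p i, n)) :
  mxdot A B = \sum_i mxdot (submxcol A i) (submxcol B i).
Proof.
rewrite -{1}(submxcolK A) -{1}(submxcolK B) /mxdot tr_mxcol mul_mxrow_mxcol.
by rewrite raddf_sum.
Qed.

Lemma mxdot_tr m n (A B : 'M[R]_(m, n)) : mxdot A^T B^T = mxdot A B.
Proof. by rewrite /mxdot -mxtrace_tr trmx_mul !trmxK mxtrace_mulC. Qed.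

Lemma mxdot_mxblock k l (p : 'I_k -> nat) (q : 'I_l -> nat)
    (A B : 'M[R]_(\sum_i p i, \sum_j q j)) :
  mxdot A B = \sum_i \sum_j mxdot (submxblock A i j) (submxblock B i j).
Proof.
rewrite mxdot_mxcol; apply: eq_bigr => i _.
rewrite -mxdot_tr mxdot_mxcol; apply: eq_bigr => j _.
by rewrite -!tr_submxrow mxdot_tr -!submxblockEv.
Qed.

End FrobeniusProduct.

(** * Orthogonal projections on linear subspaces *)

Definition linear_set (R : realType) m n (W : set 'M[R]_(m, n)) : Prop :=
  W 0 /\ forall a A B, W A -> W B -> W (a *: A + B).

Section OrthogonalProjection.
Variables (R : realType) (m n : nat).
Implicit Types (W : set 'M[R]_(m, n)) (A B P : 'M[R]_(m, n)).

(** One Gram-Schmidt step for each vector of the list: the new vector v is first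
    replaced by its component v' orthogonal to the span already treated. *)
Lemma span_orth_proj (X : seq 'M[R]_(m, n)) A :
  exists2 P, P \in <<X>>%VS & forall B, B \in <<X>>%VS -> mxdot (A - P) B = 0.
Proof.
elim: X A => [|v X IH] A.
  exists 0; first exact: mem0v.
  by move=> B; rewrite span_nil memv0 => /eqP ->; rewrite mxdot0r.
have [Pv PvX Pv0] := IH v; have [P PX P0] := IH A.
pose v' := v - Pv; pose c := mxdot A v' / mxdot v' v'.
have Xv' : v' \in <<v :: X>>%VS.
  rewrite span_cons memvB //; first by rewrite (subvP (addvSl _ _)) ?memv_line.
  by rewrite (subvP (addvSr _ _)).
have Pv' : mxdot P v' = 0 by rewrite mxdotC Pv0.
exists (P + c *: v').
  by rewrite memvD ?memvZ // span_cons (subvP (addvSr _ _)).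
move=> B; rewrite span_cons => /memv_addP[_ /vlineP[k ->] [B' B'X ->]].
have -> : k *: v + B' = k *: v' + (k *: Pv + B').
  by rewrite /v' scalerBr addrA subrK.
rewrite mxdotDr mxdotZr opprD addrA mxdotBl mxdotZl.
have -> : mxdot (A - P) v' - c * mxdot v' v' = 0.
  rewrite mxdotBl Pv' subr0 /c.
  (* If v' = 0 the quotient c is 0, and the correction term vanishes. *)
  have [/eqP|v'0] := eqVneq (mxdot v' v') 0; last by rewrite divfK ?subrr.
  by rewrite mxdot_eq0 => /eqP ->; rewrite !mxdot0r mulr0 subrr.
have PB : k *: Pv + B' \in <<X>>%VS by rewrite memvD ?memvZ.
by rewrite mulr0 add0r mxdotBl mxdotZl P0 // Pv0 // mulr0 subrr.
Qed.

(** A subspace given by a predicate is the largest-dimensional detachable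
    subspace that it contains: a larger one could be built from any vector left
    out. *)
Lemma linear_set_vspace W : linear_set W ->
  exists U : {vspace 'M[R]_(m, n)}, forall A, W A <-> A \in U.
Proof.
move=> [W0 WL].
pose fits d := `[< exists2 U : {vspace 'M[R]_(m, n)},
  \dim U = d & forall A, A \in U -> W A >].
have ex0 : exists d, fits d.
  exists 0%N; apply/asboolP; exists 0%VS; first exact: dimv0.
  by move=> A; rewrite memv0 => /eqP ->.
have bnd d : fits d -> (d <= \dim {: 'M[R]_(m, n)})%N.
  by move=> /asboolP[U <- _]; exact: dimvS (subvf U).
case: (ex_maxnP ex0 bnd) => d /asboolP[U Ud UW] dmax.
exists U => A; split=> [WA|]; last exact: UW.
have : fits (\dim (U + <[A]>)%VS).
  apply/asboolP; exists (U + <[A]>)%VS => // B.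
  case/memv_addP => B1 /UW WB1 [_ /vlineP[k ->] ->].
  by rewrite addrC; exact: WL.
move=> /dmax; rewrite -Ud => le_dim.
have /eqP -> : (U == U + <[A]>)%VS by rewrite eqEdim addvSl le_dim.
by rewrite (subvP (addvSr _ _)) ?memv_line.
Qed.

Section Subspace.
Variable W : set 'M[R]_(m, n).
Hypothesis linW : linear_set W.

Lemma linear_setD A B : W A -> W B -> W (A + B).
Proof. by move=> WA WB; rewrite -(scale1r A); exact: linW.2. Qed.

Lemma linear_setZ a A : W A -> W (a *: A).
Proof. by move=> WA; rewrite -(addr0 (a *: A)); apply: linW.2 => //; case: linW. Qed.

Lemma linear_setB A B : W A -> W B -> W (A - B).
Proof. by move=> WA WB; rewrite -scaleN1r addrC; exact: linW.2. Qed.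

(** Gram-Schmidt on a basis of W provides a witness, so the choice made in the
    definition of the projection never falls back on its default value. *)
Lemma orth_projP A :
  W (orth_proj W A) /\ forall B, W B -> mxdot (A - orth_proj W A) B = 0.
Proof.
have [U UW] := linear_set_vspace linW.
have [P PU P0] := span_orth_proj (vbasis U) A.
rewrite /orth_proj; case: xgetP => [_ -> //|/(_ P) []].
split; first by apply/UW; rewrite -(span_basis (vbasisP U)).
by move=> B /UW; rewrite -{1}(span_basis (vbasisP U)) => /P0.
Qed.

Lemma orth_proj_in A : W (orth_proj W A).
Proof. by case: (orth_projP A). Qed.

Lemma mxdot_orth_proj A B : W B -> mxdot (orth_proj W A) B = mxdot A B.
Proof.
by move=> /(orth_projP A).2 /eqP; rewrite mxdotBl subr_eq0 => /eqP.
Qed.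

Lemma orth_proj_unique A P :
  W P -> (forall B, W B -> mxdot (A - P) B = 0) -> orth_proj W A = P.
Proof.
move=> WP P0; apply/eqP; rewrite -subr_eq0 -mxdot_eq0.
have WD : W (orth_proj W A - P) by apply: linear_setB => //; exact: orth_proj_in.
rewrite {1}mxdotBl mxdot_orth_proj // -mxdotBl P0 //.
Qed.

Lemma orth_proj_id A : W A -> orth_proj W A = A.
Proof.
by move=> WA; apply: orth_proj_unique => // B _; rewrite subrr mxdot0l.
Qed.

Lemma orth_proj_eq0 A : (forall B, W B -> mxdot A B = 0) -> orth_proj W A = 0.
Proof.
by move=> A0; apply: orth_proj_unique; [case: linW|rewrite subr0].
Qed.

Lemma orth_proj_linear : linear (orth_proj W).
Proof.
move=> a A B; apply: orth_proj_unique.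
  by apply: linW.2; exact: orth_proj_in.
move=> C WC; rewrite mxdotBl !mxdotDl !mxdotZl !mxdot_orth_proj //.
by rewrite subrr.
Qed.

Lemma orth_projD A B : orth_proj W (A + B) = orth_proj W A + orth_proj W B.
Proof. by rewrite -{1}(scale1r A) orth_proj_linear scale1r. Qed.

Lemma orth_projZ a A : orth_proj W (a *: A) = a *: orth_proj W A.
Proof.
by rewrite -[a *: A]addr0 orth_proj_linear (orth_proj_id (proj1 linW)) addr0.
Qed.

End Subspace.
End OrthogonalProjection.

(** * Limits and derivatives of matrix-valued functions *)

Section MatrixCalculus.
Variable R : realType.

(** The norm of a matrix is the maximum of its finitely many entries, so that
    analysis on matrices reduces to analysis of the entries. *)
Lemma cvg_mxP m n (T : Type) (F : set_system T) (FF : Filter F)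
    (f : T -> 'M[R]_(m, n)) (A : 'M[R]_(m, n)) :
  f x @[x --> F] --> A <-> forall i j, f x i j @[x --> F] --> A i j.
Proof.
split=> [fA i j|fA].
  exact: (cvg_comp _ _ fA (@coord_continuous R m n i j A)).
apply/cvgrPdist_le => /= e e0.
near=> x.
rewrite /Num.Def.normr/= mx_normrE (bigmax_le _ (ltW e0))//= => i _.
rewrite !mxE/=.
move: i; near: x; apply: filter_forall => /= i.
exact: ((cvgrPdist_le _ _).1 (fA i.1 i.2)).
Unshelve. all: by end_near. Qed.

Lemma cvg_sumr (V : normedModType R) (I : Type) (r : seq I) (T : Type)
    (F : set_system T) (FF : Filter F) (f : I -> T -> V) (a : I -> V) :
  (forall i, f i x @[x --> F] --> a i) ->
  \sum_(i <- r) f i x @[x --> F] --> \sum_(i <- r) a i.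
Proof. by move=> fa; apply: cvg_big => //; exact: add_continuous. Qed.

Lemma cvg_mulmx m n p (T : Type) (F : set_system T) (FF : Filter F)
    (f : T -> 'M[R]_(m, n)) (g : T -> 'M[R]_(n, p))
    (A : 'M[R]_(m, n)) (B : 'M[R]_(n, p)) :
  f x @[x --> F] --> A -> g x @[x --> F] --> B ->
  f x *m g x @[x --> F] --> A *m B.
Proof.
move=> /cvg_mxP fA /cvg_mxP gB; apply/cvg_mxP => i j; rewrite mxE.
under eq_cvg do rewrite mxE.
by apply: cvg_sumr => k; apply: cvgM.
Qed.

Lemma cvg_trmx m n (T : Type) (F : set_system T) (FF : Filter F)
    (f : T -> 'M[R]_(m, n)) (A : 'M[R]_(m, n)) :
  f x @[x --> F] --> A -> (f x)^T @[x --> F] --> A^T.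
Proof.
move=> /cvg_mxP fA; apply/cvg_mxP => i j; rewrite mxE.
by under eq_cvg do rewrite mxE; exact: fA.
Qed.

Lemma cvg_mxdot m n (T : Type) (F : set_system T) (FF : Filter F)
    (f g : T -> 'M[R]_(m, n)) (A B : 'M[R]_(m, n)) :
  f x @[x --> F] --> A -> g x @[x --> F] --> B ->
  mxdot (f x) (g x) @[x --> F] --> mxdot A B.
Proof.
move=> /cvg_mxP fA /cvg_mxP gB; rewrite mxdotE.
under eq_cvg do rewrite mxdotE.
by apply: cvg_sumr => i; apply: cvg_sumr => j; apply: cvgM.
Qed.

Lemma linear_mx_continuous m n p q (f : 'M[R]_(m, n) -> 'M[R]_(p, q)) :
  linear f -> continuous f.
Proof.
move=> linf; pose lf := GRing.isLinear.Build _ _ _ _ f linf.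
pose F : {linear 'M[R]_(m, n) -> 'M[R]_(p, q)} := HB.pack f lf.
have -> : f = fun x => \sum_i \sum_j x i j *: F (delta_mx i j).
  apply/funext => x; rewrite -[f]/(F : _ -> _) {1}(matrix_sum_delta x).
  rewrite linear_sum; apply: eq_bigr => i _.
  by rewrite linear_sum; apply: eq_bigr => j _; rewrite linearZ.
move=> A.
apply: (@cvg_sumr _ _ _ _ (nbhs A) _
  (fun i x => \sum_j x i j *: F (delta_mx i j))) => i.
apply: (@cvg_sumr _ _ _ _ (nbhs A) _
  (fun j x => x i j *: F (delta_mx i j))) => j.
by apply: (@cvgZr_tmp _ _ _ (nbhs A)); exact: coord_continuous.
Qed.

(** W is the zero set of the continuous function |A - P A|^2. *)
Lemma linear_set_closed m n (W : set 'M[R]_(m, n)) : linear_set W -> closed W.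
Proof.
move=> linW.
pose h A := A - orth_proj W A.
have -> : W = (fun A => mxdot (h A) (h A)) @^-1` [set x | x = 0].
  apply/seteqP; split=> A /= => [WA|/eqP].
    by rewrite /h orth_proj_id ?subrr ?mxdot0l.
  by rewrite mxdot_eq0 subr_eq0 => /eqP ->; exact: orth_proj_in.
apply: (continuous_closedP _).1; last exact: closed_eq.
move=> A; have hA : h B @[B --> A] --> h A.
  apply: (@cvgB _ _ _ (nbhs A)); first exact: cvg_id.
  exact/linear_mx_continuous/orth_proj_linear.
exact: (@cvg_mxdot _ _ _ (nbhs A)).
Qed.

Lemma is_derive_mxP m n (f : R -> 'M[R]_(m, n)) (t : R) df :
  is_derive t 1 f df <-> forall i j, is_derive t 1 (fun s => f s i j) (df i j).
Proof.
split=> [[fd <-] i j|H].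
  apply: DeriveDef; first exact: (derivable_mxP _ _ _).1.
  by rewrite derive_mx // mxE.
have fd : derivable f t 1 by apply/derivable_mxP => i j; case: (H i j).
apply: DeriveDef => //; rewrite derive_mx //; apply/matrixP => i j.
by rewrite mxE; case: (H i j).
Qed.

Lemma is_derive_mulmx m n p (f : R -> 'M[R]_(m, n)) (g : R -> 'M[R]_(n, p))
    (t : R) (df : 'M[R]_(m, n)) (dg : 'M[R]_(n, p)) :
  is_derive t 1 f df -> is_derive t 1 g dg ->
  is_derive t 1 (fun s => f s *m g s) (df *m g t + f t *m dg).
Proof.
move=> /is_derive_mxP Df /is_derive_mxP Dg; apply/is_derive_mxP => i j.
have -> : (fun s => (f s *m g s) i j) =
    \sum_k ((fun s => f s i k) * (fun s => g s k j)).
  by apply/funext => s; rewrite mxE fct_sumE.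
apply: is_derive_eq; rewrite !mxE -big_split /=; apply: eq_bigr => k _.
by rewrite addrC mulrC; congr (_ + _); rewrite /GRing.scale /= mulrC.
Qed.

Lemma is_derive_mxdot m n (f g : R -> 'M[R]_(m, n)) (t : R)
    (df dg : 'M[R]_(m, n)) :
  is_derive t 1 f df -> is_derive t 1 g dg ->
  is_derive t 1 (fun s => mxdot (f s) (g s)) (mxdot df (g t) + mxdot (f t) dg).
Proof.
move=> /is_derive_mxP Df /is_derive_mxP Dg.
have -> : (fun s => mxdot (f s) (g s)) =
    \sum_i \sum_j ((fun s => f s i j) * (fun s => g s i j)).
  apply/funext => s; rewrite mxdotE fct_sumE; apply: eq_bigr => i _.
  by rewrite fct_sumE.
apply: is_derive_eq; rewrite !mxdotE -big_split /=; apply: eq_bigr => i _.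
rewrite -big_split /=; apply: eq_bigr => j _.
by rewrite addrC /GRing.scale /=; congr (_ + _); rewrite mulrC.
Qed.

Lemma mx_increment_le m n (f df : R -> 'M[R]_(m, n)) (M a b : R) :
  a <= b -> (forall t, t \in `]a, b[ -> is_derive t 1 f (df t)) ->
  {within `[a, b], continuous f} ->
  (forall t, t \in `[a, b] -> `|df t| <= M) ->
  `|f b - f a| <= M * (b - a).
Proof.
move=> ab fd fc dfM.
have M0 : 0 <= M by apply: le_trans (dfM a _); rewrite // in_itv /= lexx ab.
rewrite {1}/Num.Def.normr/= mx_normrE (bigmax_le _ _)//=.
  by rewrite mulr_ge0 // subr_ge0.
move=> [i j] _ /=; rewrite !mxE.
have [||c cab ->] := @MVT_segment R (fun t => f t i j) (fun t => df t i j) a b ab.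
- by move=> x /fd /is_derive_mxP.
- move=> x; have /cvg_mxP := fc x; exact.
rewrite normrM (ger0_norm (_ : 0 <= b - a)) ?subr_ge0 //.
rewrite ler_wpM2r ?subr_ge0 //; apply: le_trans (dfM c cab).
by rewrite [leRHS]/Num.Def.normr/= mx_normrE; exact: (le_bigmax _ _ (i, j)).
Qed.

Lemma is_derive_nonincreasing (f df : R -> R) :
  {within `[0, +oo[, continuous f} ->
  (forall t : R, 0 < t -> is_derive t 1 f (df t)) ->
  (forall t : R, 0 < t -> df t <= 0) -> nonincreasing_nonneg f.
Proof.
move=> fc fd df0 s t s0 st.
apply: (ler0_derive1_nincry _ _ fc s0 st) => x; rewrite in_itv /= andbT => x0.
  by case: (fd x x0).
by rewrite derive1E; case: (fd x x0) => _ ->; exact: df0.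
Qed.

End MatrixCalculus.

(** * The dissipation identity and its consequences *)

Section Dynamics.
Variables (R : realType) (n m : nat) (G : graph n m).
Variables (dV : 'I_n -> nat) (dE : 'I_m -> nat).
Variable S : forall v, {vspace 'cV[R]_(dV v)}.
Variable I : {set 'I_n * 'I_m}.
Hypothesis hI : I \subset incidences G.

Local Notation cochain0 := 'cV[R]_(\sum_(v < n) dV v).
Local Notation structure := 'M[R]_(\sum_(e < m) dE e, \sum_(v < n) dV v).
Local Notation CQ := (C0_Q S).
Local Notation velocities := (@structure_velocities R n m dV dE I).

Lemma submxcolZ k (p : 'I_k -> nat) q a (A : 'M[R]_(\sum_i p i, q)) i :
  submxcol (a *: A) i = a *: submxcol A i.
Proof. by apply/matrixP => r c; rewrite !mxE. Qed.

Lemma submxblockZ k l (p : 'I_k -> nat) (q : 'I_l -> nat) a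
    (A : 'M[R]_(\sum_i p i, \sum_j q j)) i j :
  submxblock (a *: A) i j = a *: submxblock A i j.
Proof. by apply/matrixP => r c; rewrite !mxE. Qed.

Lemma C0_Q_linear : linear_set CQ.
Proof.
split=> [v s _|a x y Qx Qy v s Sv]; first by rewrite submxcol0 mxdot0r.
by rewrite submxcolD submxcolZ mxdotDr mxdotZr Qx // Qy // mulr0 addr0.
Qed.

Lemma C0_S_linear : linear_set (C0_S S).
Proof.
split=> [v|a x y Sx Sy v]; first by rewrite submxcol0 mem0v.
by rewrite submxcolD submxcolZ memvD ?memvZ ?Sx ?Sy.
Qed.

Lemma C0_S_orth x y : C0_S S x -> CQ y -> mxdot x y = 0.
Proof. by move=> Sx Qy; rewrite mxdot_mxcol big1 // => v _; exact/Qy/Sx. Qed.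

Lemma structure_velocities_linear : linear_set velocities.
Proof.
split=> [e v _|a A B VA VB e v Ive]; first by rewrite submxblock0.
by rewrite submxblockD submxblockZ VA // VB // scaler0 addr0.
Qed.

Lemma is_coboundaryP (d : structure) : is_coboundary G d <->
  forall e v, ~~ incident G v e -> submxblock d e v = 0.
Proof.
split=> [[rho ->] e v|d0].
  by rewrite negb_or mxblockK => /andP[/negbTE -> /negbTE ->].
exists (fun e v => if v == tgt G e then submxblock d e v else - submxblock d e v).
apply/mxblockP => e v; rewrite mxblockK.
have [//|vt] := eqVneq v (tgt G e).
have [_|vs] := eqVneq v (src G e); first by rewrite opprK.
by apply: d0; rewrite negb_or vs.
Qed.

Lemma is_coboundary_linear : linear_set [set d : structure | is_coboundary G d].
Proof.
split=> [|a A B /is_coboundaryP A0 /is_coboundaryP B0]; apply/is_coboundaryP.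
  by move=> e v _; rewrite submxblock0.
by move=> e v ve; rewrite submxblockD submxblockZ A0 // B0 // scaler0 addr0.
Qed.

Variables alpha beta : R.
Hypotheses (halpha : 0 < alpha) (hbeta : 0 < beta).
Variable u : cochain0.

(** The rate at which the disagreement energy is lost. *)
Definition dissipation (y : cochain0) (d : structure) : R :=
  let g := orth_proj CQ (d^T *m d *m (u + y)) in
  let h := orth_proj velocities (d *m (u + y) *m (u + y)^T) in
  alpha * mxdot g g + beta * mxdot h h.

Lemma dissipation_ge0 y d : 0 <= dissipation y d.
Proof. by rewrite addr_ge0 // mulr_ge0 ?mxdot_ge0 // ltW. Qed.

Lemma dissipation_eq0 y d : dissipation y d = 0 ->
  opinion_velocity S alpha u y d = 0 /\ structure_velocity I beta u y d = 0.
Proof.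
move=> /eqP; rewrite paddr_eq0 ?mulr_ge0 ?mxdot_ge0 ?ltW //.
rewrite !mulf_eq0 (gt_eqF halpha) (gt_eqF hbeta) /= !mxdot_eq0.
by case/andP => /eqP g0 /eqP h0; rewrite /opinion_velocity /structure_velocity
  g0 h0 !scaler0.
Qed.

Lemma disagreementE (y : cochain0) (d : structure) :
  disagreement u y d = 2^-1 * mxdot (d *m (u + y)) (d *m (u + y)).
Proof. by rewrite /disagreement frobenius_norm_sqr. Qed.

Lemma disagreement_ge0 (y : cochain0) (d : structure) : 0 <= disagreement u y d.
Proof. by rewrite disagreementE mulr_ge0 ?mxdot_ge0 // invr_ge0. Qed.

Section Trajectory.
Variables (y : R -> cochain0) (d : R -> structure).
Hypothesis sol : solution G S I alpha beta u y d.

(** The velocity of x is - alpha g and that of delta is - beta h.  Moving the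
    factors x and delta across the inner product, <h x, delta x> is the product of
    h with delta x x^T, and <delta g, delta x> that of g with delta^T delta x;
    both are products of a projection with the vector projected, hence squared
    norms. *)
Lemma disagreement_derive (t : R) : 0 < t ->
  is_derive t 1 (fun s => disagreement u (y s) (d s)) (- dissipation (y t) (d t)).
Proof.
move=> t0.
have Dy := sol_opinion_ode sol t0; have Dd := sol_structure_ode sol t0.
have Dx : is_derive t 1 (fun s => u + y s) (opinion_velocity S alpha u (y t) (d t)).
  by rewrite -[X in is_derive _ _ _ X]add0r; exact: (is_deriveD (f := cst u)).
have De := is_derive_mulmx Dd Dx.
have -> : (fun s => disagreement u (y s) (d s)) =
    2^-1 \*: (fun s => mxdot (d s *m (u + y s)) (d s *m (u + y s))).
  by apply/funext => s; rewrite disagreementE.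
have DD := is_derive_mxdot De De.
apply: is_derive_eq; rewrite [X in _ + X]mxdotC -mulr2n.
rewrite /GRing.scale /= mulrnAr -mulrnAl -[_ *+ 2]mulr_natr mulVf ?pnatr_eq0 //.
rewrite mul1r.
set x := u + y t; set D := d t.
rewrite /dissipation -/x -/D /structure_velocity /opinion_velocity -/x -/D.
set h := orth_proj _ (D *m x *m x^T); set g := orth_proj _ (D^T *m D *m x).
rewrite mxdotDl -scalemxAl -scalemxAr !mxdotZl.
have -> : mxdot (h *m x) (D *m x) = mxdot h h.
  rewrite mxdot_mulr mxdotC; apply/esym/mxdot_orth_proj.
    exact: structure_velocities_linear.
  by apply: orth_proj_in; exact: structure_velocities_linear.
have -> : mxdot (D *m g) (D *m x) = mxdot g g.
  rewrite mxdot_mull mulmxA mxdotC; apply/esym/mxdot_orth_proj.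
    exact: C0_Q_linear.
  by apply: orth_proj_in; exact: C0_Q_linear.
by ring.
Qed.

Lemma disagreement_continuous :
  {within `[0, +oo[, continuous (fun s => disagreement u (y s) (d s))}.
Proof.
have -> : (fun s => disagreement u (y s) (d s)) =
    fun s => 2^-1 * mxdot (d s *m (u + y s)) (d s *m (u + y s)).
  by apply/funext => s; rewrite disagreementE.
move=> t; pose F := nbhs (t : subspace `[0, +oo[).
have FF : Filter F := nbhs_filter _.
have cy : y s @[s --> F] --> y t := sol_opinion_cont sol (x := t).
have cd : d s @[s --> F] --> d t := sol_structure_cont sol (x := t).
have cx : u + y s @[s --> F] --> u + y t.
  by apply: cvgD => //; exact: cvg_cst.
have ce := cvg_mulmx FF cd cx.
exact: (@cvgMl_tmp _ _ F FF _ _ _ (cvg_mxdot FF ce ce)).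
Qed.

Lemma disagreement_nonincreasing :
  nonincreasing_nonneg (fun t => disagreement u (y t) (d t)).
Proof.
apply: (is_derive_nonincreasing disagreement_continuous disagreement_derive).
by move=> t _; rewrite oppr_le0 dissipation_ge0.
Qed.

(** Only the adapting part AI of A is seen by a structure velocity.  On a Type S
    edge the row of AI is the whole row of A or zero, since blocks of A at
    non-incident pairs vanish; so <AI x, A x> is a sum of squares. *)
Lemma type_S_alignment (x : cochain0) (A : structure) :
  (forall e, e \in type_S G I) -> is_coboundary G A ->
  0 <= mxdot A (orth_proj velocities (A *m x *m x^T)).
Proof.
move=> allS /is_coboundaryP A0.
pose AI : structure :=
  \mxblock_(e, v) (if (v, e) \in I then submxblock A e v else 0).
have linM := structure_velocities_linear.
have VAI : velocities AI.
  by move=> e v /negbTE Ive; rewrite mxblockK Ive.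
set h := orth_proj _ _; have Vh : velocities h by exact: orth_proj_in.
have -> : mxdot A h = mxdot AI h.
  rewrite !mxdot_mxblock; apply: eq_bigr => e _; apply: eq_bigr => v _.
  rewrite mxblockK; case: ifPn => // Ive; by rewrite Vh // !mxdot0r.
rewrite mxdotC mxdot_orth_proj // mxdot_mulr trmxK mxdotC.
rewrite mxdot_mxcol sumr_ge0 // => e _; rewrite -!submxcol_mul.
have := allS e; rewrite inE => /orP[] /andP[Is It].
  have -> : submxcol AI e = submxcol A e.
    apply/mxrowP => v; rewrite -!submxblockEv mxblockK; case: ifPn => // Ive.
    rewrite A0 // negb_or; apply/andP; split; apply: contra Ive => /eqP -> //.
  exact: mxdot_ge0.
have -> : submxcol AI e = 0.
  apply/mxrowP => v; rewrite -submxblockEv mxblockK; case: ifPn => [Ive|].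
    have := fintype.subsetP hI _ Ive; rewrite inE /incident /=.
    by case/orP => /eqP ve; move: Ive; rewrite ve ?(negbTE Is) ?(negbTE It).
  by move=> _; apply/matrixP => r c; rewrite !mxE.
by rewrite mul0mx mxdot0l.
Qed.

Lemma frobenius_norm_nonincreasing : (forall e, e \in type_S G I) ->
  nonincreasing_nonneg (fun t => frobenius_norm (d t)).
Proof.
move=> allS.
suff H : nonincreasing_nonneg (fun t => mxdot (d t) (d t)).
  by move=> s t s0 st; rewrite ler_sqrt ?mxdot_ge0 //; exact: H.
apply: (is_derive_nonincreasing (df := fun t =>
    mxdot (structure_velocity I beta u (y t) (d t)) (d t) +
    mxdot (d t) (structure_velocity I beta u (y t) (d t)))).
- move=> t; have cd := sol_structure_cont sol (x := t).
  exact: (cvg_mxdot (nbhs_filter _) cd cd).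
- move=> t t0; have Dd := sol_structure_ode sol t0; exact: is_derive_mxdot.
move=> t t0; rewrite mxdotC -mulr2n mxdotZr mulNr mulNrn oppr_le0 mulrn_wge0 //.
rewrite mulr_ge0 ?(ltW hbeta) //; apply: type_S_alignment => //.
exact: (sol_structure_space sol (ltW t0)).
Qed.

End Trajectory.
End Dynamics.

(** * A scalar autonomous equation *)

Section ScalarFlow.
Variables (R : realType) (w dw : R -> R) (L : R).
Hypothesis Dw : forall x : R, is_derive x 1 w (dw x).
Hypothesis w0 : w 0 = 0.
Hypothesis dw_gt0 : forall x : R, x <= 0 -> 0 < dw x.
Hypothesis dw_leL : forall x : R, x <= 0 -> dw x <= L.

(** Mean value theorem between x and the zero of w. *)
Let w_slope (x : R) : x < 0 -> exists2 c, c < 0 & - w x = dw c * - x.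
Proof.
move=> x0.
have [|c cx] := MVT x0 (fun z _ => Dw z).
  apply: continuous_subspaceT => z; apply: differentiable_continuous.
  by apply/derivable1_diffP; case: (Dw z).
rewrite w0 !sub0r => wE; exists c => //.
by move: cx; rewrite in_itv /= => /andP[].
Qed.

Let w_lt0 (x : R) : x < 0 -> 0 < - w x.
Proof.
by move=> x0; have [c c0 ->] := w_slope x0; rewrite mulr_gt0 ?oppr_gt0 ?dw_gt0 // ltW.
Qed.

Let w_ge (x : R) : x < 0 -> - w x <= L * - x.
Proof.
move=> x0; have [c c0 ->] := w_slope x0.
by rewrite ler_wpM2r ?dw_leL ?oppr_ge0 // ltW.
Qed.

(** T is the time needed to go from -1 to x at speed - w; the integral starts at
    -2 so that T is differentiable on both sides of -1. *)
Let f (x : R) : R := (- w x)^-1.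
Let F (x : R) : R := (\int[lebesgue_measure]_(t in `[-2, x]) f t)%R.
Let T (x : R) : R := F x - F (-1).

Let f_gt0 (x : R) : x < 0 -> 0 < f x.
Proof. by move=> x0; rewrite invr_gt0 w_lt0. Qed.

Let f_cont (x : R) : x < 0 -> {for x, continuous f}.
Proof.
move=> x0; apply: cvgV; first by rewrite gt_eqF // w_lt0.
apply: cvgN; apply: differentiable_continuous.
by apply/derivable1_diffP; case: (Dw x).
Qed.

Let T_derive (x : R) : -2 < x -> x < 0 -> is_derive x 1 T (f x).
Proof.
move=> x2 x0; have xu : x < x / 2 by lra.
have u0 : x / 2 < 0 by lra.
have [|dF FE] := @continuous_FTC1_closed _ f (-2) x (x / 2) xu _ x2 (f_cont x0).
  apply: continuous_compact_integrable; first exact: segment_compact.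
  rewrite continuous_subspace_in => z; rewrite inE /= => zu.
  apply: continuous_subspaceT_for => //; apply: f_cont.
  by rewrite (le_lt_trans _ u0) ?(itvP zu).
have DF : is_derive x 1 F (f x).
  by apply: (DeriveDef dF); rewrite -derive1E; exact: FE.
rewrite -[f x]subr0; exact: is_deriveB.
Qed.


Let T_continuous (x : R) : -2 < x -> x < 0 -> {for x, continuous T}.
Proof.
move=> x2 x0; apply: differentiable_continuous.
by apply/derivable1_diffP; case: (T_derive x2 x0).
Qed.

Let T_within (a b : R) : -2 < a -> b < 0 -> {within `[a, b], continuous T}.
Proof.
move=> a2 b0; rewrite continuous_subspace_in => z.
rewrite inE /= => abz; apply: continuous_subspaceT_for => //.
by apply: T_continuous; rewrite ?(lt_le_trans a2) ?(le_lt_trans _ b0) ?(itvP abz).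
Qed.

Let T_lt (x z : R) : -2 < x -> x < z -> z < 0 -> T x < T z.
Proof.
move=> x2 xz z0; rewrite -subr_gt0.
have [c cxz|c /itvP cxz ->] := @MVT _ T f x z xz _ (T_within x2 z0).
  by apply: T_derive; rewrite ?(lt_trans x2) ?(lt_trans _ z0) ?(itvP cxz).
by rewrite mulr_gt0 ?subr_gt0 // f_gt0 // (lt_trans _ z0) // cxz.
Qed.

Let T_inj (x z : R) : -2 < x < 0 -> -2 < z < 0 -> T x = T z -> x = z.
Proof.
move=> /andP[x2 x0] /andP[z2 z0] xz; apply/eqP; case: ltgtP => // lt.
  by have := T_lt x2 lt z0; rewrite xz ltxx.
by have := T_lt z2 lt x0; rewrite xz ltxx.
Qed.

(** The speed is at most L |x|, so the time to reach x is at least that needed at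
    speed L |x|: the rest point 0 is not reached in finite time. *)
Let T_ge (x : R) : -1 <= x -> x < 0 -> - (L^-1 * ln (- x)) <= T x.
Proof.
move=> x1 x0; have L0 : 0 < L by rewrite (lt_le_trans _ (dw_leL (lexx 0))) ?dw_gt0.
pose h (z : R) := T z + L^-1 * ln (- z).
have Dh (z : R) : -2 < z -> z < 0 -> is_derive z 1 h (f z + L^-1 * z^-1).
  move=> z2 z0; have DT := T_derive z2 z0.
  have Nz : 0 < - z by rewrite oppr_gt0.
  have Dl := is_derive1_comp (is_derive1_ln Nz) (is_deriveNid z 1).
  have -> : h = T + L^-1 \*: (@ln R \o -%R) by [].
  apply: is_deriveD; apply: is_deriveZ; apply: is_derive_eq Dl _.
  by rewrite mulrN1 invrN opprK.
have hc : {within `[-1, x], continuous h}.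
  rewrite continuous_subspace_in => z; rewrite inE /= in_itv /= => zx.
  apply: continuous_subspaceT_for; first by rewrite /= in_itv /= zx.
  apply: differentiable_continuous; apply/derivable1_diffP.
  move: zx => /andP[z1 zx].
  have z2 : -2 < z by lra.
  by have [] := Dh z z2 (le_lt_trans zx x0).
have [c|c] := @MVT_segment _ h (fun z => f z + L^-1 * z^-1) _ _ x1 _ hc.
  by rewrite in_itv /= => /andP[c1 cx]; apply: Dh; lra.
rewrite in_itv /= => /andP[c1 cx] hE.
have c0 : c < 0 by lra.
suff : 0 <= h x - h (-1).
  by rewrite /h opprK ln1 mulr0 addr0 /T subrr subr0 -lerBlDr sub0r.
rewrite hE mulr_ge0 ?subr_ge0 // -lerBlDr sub0r -mulrN -invrN -invfM.
by rewrite lef_pV2 ?w_ge // posrE ?w_lt0 ?mulr_gt0 ?oppr_gt0.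
Qed.

Let theta (t : R) : R := xget 0 [set x | -2 < x < 0 /\ T x = t].

Let thetaK (x : R) : -2 < x < 0 -> theta (T x) = x.
Proof.
rewrite /theta => x20; case: xgetP => [z _ [z20 zx]|/(_ x)]; first exact: T_inj.
by case.
Qed.

Let T_onto (t : R) : 0 <= t -> exists2 x, -1 <= x < 0 & T x = t.
Proof.
move=> t0; have L0 : 0 < L by rewrite (lt_le_trans _ (dw_leL (lexx 0))) ?dw_gt0.
(* The point reached at time t by the flow at speed L |x| from -1. *)
pose b : R := - expR (- (L * t)).
have b0 : b < 0 by rewrite oppr_lt0 expR_gt0.
have b1 : -1 <= b by rewrite lerN2 -expR0 ler_expR oppr_le0 mulr_ge0 // ltW.
have T1 : T (-1) = 0 by rewrite /T subrr.
have Tb : t <= T b.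
  apply: le_trans (T_ge b1 b0); rewrite opprK expRK mulrN opprK.
  by rewrite mulrA mulVf ?mul1r // gt_eqF.
have [||c] := @IVT _ T (-1) b t b1.
- by apply: T_within; lra.
- by rewrite T1 ge_min t0 le_max Tb orbT.
rewrite in_itv /= => /andP[c1 cb] Tc; exists c => //.
by rewrite c1 (le_lt_trans cb).
Qed.

(** The solution is the inverse function of the travel time T, which is onto
    [0, +oo[ because the rest point is infinitely far away in time. *)
Lemma scalar_flow : exists theta : R -> R, [/\ theta 0 = -1,
  forall t, 0 <= t -> theta t < 0,
  forall t, 0 < t -> -1 < theta t &
  forall t : R, 0 <= t -> is_derive t 1 theta (- w (theta t))].
Proof.
have T1 : T (-1) = 0 by rewrite /T subrr.
exists theta; split.
- by rewrite -T1 thetaK //; lra.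
- by move=> t /T_onto[x /andP[x1 x0] <-]; rewrite thetaK ?x0 //; lra.
- move=> t t0; have [x /andP[x1 x0] xt] := T_onto (ltW t0).
  rewrite -xt thetaK ?x0 ?andbT; last by lra.
  rewrite lt_neqAle x1 andbT; apply: contraTneq t0 => x1'.
  by rewrite -xt -x1' T1 ltxx.
move=> t /T_onto[x /andP[x1 x0] <-].
have x2 : -2 < x by lra.
rewrite thetaK ?x2 // -[- w x]invrK -/(f x).
have near2 : \forall z \near x, z \in `]-2, 0[.
  by apply: near_in_itvoo; rewrite in_itv /= x2.
apply: is_derive_inverse; last by rewrite gt_eqF // f_gt0.
- by apply: filterS near2 => z; rewrite in_itv /=; exact: thetaK.
- by apply: filterS near2 => z; rewrite in_itv /= => /andP[]; exact: T_continuous.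
exact: T_derive.
Qed.

End ScalarFlow.

(** * Growth of the norm at an asymmetric edge *)

Section Concentrated.
Variables (R : realType) (k : nat) (p : 'I_k -> nat).

Definition concentrated i (xi : 'cV[R]_(p i)) : 'cV[R]_(\sum_j p j) :=
  \mxcol_j eqtype.dfwith (fun j => 0 : 'cV[R]_(p j)) xi j.

Lemma concentrated_in i (xi : 'cV[R]_(p i)) : submxcol (concentrated xi) i = xi.
Proof. by rewrite mxcolK eqtype.dfwith_in. Qed.

Lemma concentrated_out i (xi : 'cV[R]_(p i)) j :
  i != j -> submxcol (concentrated xi) j = 0.
Proof. by move=> ij; rewrite mxcolK eqtype.dfwith_out. Qed.

Lemma mxdot_concentrated i (xi : 'cV[R]_(p i)) x :
  mxdot (concentrated xi) x = mxdot xi (submxcol x i).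
Proof.
rewrite mxdot_mxcol (bigD1 i) //= concentrated_in big1 ?addr0 // => j.
by rewrite eq_sym => ij; rewrite concentrated_out // mxdot0l.
Qed.

End Concentrated.

(** Project any nonzero vector on V: either the projection is nonzero and lies in
    V, or the vector is orthogonal to V; then normalize. *)
Lemma unit_vector_in_or_orth (R : realType) k (V : {vspace 'cV[R]_k}) :
  (0 < k)%N -> exists2 xi : 'cV[R]_k, mxdot xi xi = 1 &
    xi \in V \/ forall s, s \in V -> mxdot s xi = 0.
Proof.
move=> k0.
suff [w w0 Vw] : exists2 w : 'cV[R]_k, w != 0 &
    w \in V \/ forall s, s \in V -> mxdot s w = 0.
  have ww : 0 < mxdot w w by rewrite lt_def mxdot_eq0 w0 mxdot_ge0.
  exists ((Num.sqrt (mxdot w w))^-1 *: w).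
    rewrite mxdotZl mxdotZr mulrA -expr2 exprVn sqr_sqrtr ?ltW //.
    by rewrite mulVf // gt_eqF.
  case: Vw => [Vw|w_orth]; [left|right].
    exact: memvZ.
  by move=> s /w_orth sw; rewrite mxdotZr sw mulr0.
have linV : linear_set [set s | s \in V].
  by split=> [|a A B] /=; [exact: mem0v|move=> VA VB; rewrite memvD ?memvZ].
pose one : 'cV[R]_k := const_mx 1.
have [P0|P0] := eqVneq (orth_proj [set s | s \in V] one) 0; last first.
  exists (orth_proj [set s | s \in V] one) => //; left.
  exact: (orth_proj_in linV one).
exists one.
  apply/eqP => /matrixP/(_ (Ordinal k0) ord0) /eqP.
  by rewrite !mxE oner_eq0.
by right=> s Vs; rewrite mxdotC -(mxdot_orth_proj linV) // P0 mxdot0l.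
Qed.

Section Profile.
Variables (R : realType) (alpha beta : R).
Hypotheses (halpha : 0 < alpha) (hbeta : 0 < beta).

(** Opinion s and restriction coefficient p at the adapting end of the edge, as
    functions of the rescaled time; ea tells whether the opinion there is free,
    eb whether that at the other end is.  The bound is on the slope of p s + r,
    where r has slope eb alpha. *)
Lemma growth_profile (ea eb : bool) : exists (s p : R -> R) (L : R),
  [/\ forall x : R, is_derive x 1 s (ea%:R * alpha * p x),
      forall x : R, is_derive x 1 p (beta * s x),
      forall x, 0 < s x, (forall x, -1 <= x -> 0 <= p x) /\
      (~~ ea -> forall x, s x = 1) &
      forall x, x <= 0 ->
        beta * s x ^+ 2 + ea%:R * alpha * p x ^+ 2 + eb%:R * alpha <= L].
Proof.
case: ea => /=; last first.
  exists (cst 1), (fun x => beta * (x + 2)), (beta + eb%:R * alpha); split=> //.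
  - by move=> x; rewrite mul0r mul0r; exact: is_derive_cst.
  - move=> x; have -> : (fun x : R => beta * (x + 2)) = beta \*: (id + cst 2) by [].
    by apply: is_derive_eq; rewrite addr0.
  - split=> // x x1; rewrite mulr_ge0 ?(ltW hbeta) //; lra.
  - by move=> x _; rewrite /cst /= expr1n mulr1 !mul0r addr0.
(* With both unknowns free, the system s' = alpha p, p' = beta s has the growing
   solution proportional to (sqrt alpha, sqrt beta). *)
pose k := Num.sqrt alpha * Num.sqrt beta.
have a0 := ltW halpha; have b0 := ltW hbeta.
have sa : Num.sqrt alpha * Num.sqrt alpha = alpha by rewrite -expr2 sqr_sqrtr.
have sb : Num.sqrt beta * Num.sqrt beta = beta by rewrite -expr2 sqr_sqrtr.
have De c (x : R) : is_derive x 1 (fun x => c * expR (k * x)) (c * (k * expR (k * x))).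
  have -> : (fun x => c * expR (k * x)) = c \*: (expR \o (k \*: id)) by [].
  have Dk : is_derive x 1 (k \*: id) k.
    by apply: is_derive_eq; rewrite /GRing.scale /= mulr1.
  have D1 := is_derive1_comp (is_derive_expR (k * x)) Dk.
  by apply: is_derive_eq (is_deriveZ c D1) _; rewrite /GRing.scale /=; ring.
exists (fun x => Num.sqrt alpha * expR (k * x)),
  (fun x => Num.sqrt beta * expR (k * x)),
  (beta * alpha + 1 * alpha * beta + eb%:R * alpha); split.
- move=> x; apply: is_derive_eq (De _ _) _; rewrite -{2}sa /k; ring.
- move=> x; apply: is_derive_eq (De _ _) _; rewrite -{2}sb /k; ring.
- by move=> x; rewrite mulr_gt0 ?expR_gt0 // sqrtr_gt0.
- split=> // x _; by rewrite mulr_ge0 ?expR_ge0 // sqrtr_ge0.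
move=> x x0; rewrite !exprMn !sqr_sqrtr // lerD2r.
have e1 : expR (k * x) ^+ 2 <= 1.
  rewrite expr_le1 ?expR_ge0 // -expR0 ler_expR mulr_ge0_le0 //.
  by rewrite mulr_ge0 ?sqrtr_ge0.
rewrite -subr_ge0 (_ : _ - _ = 2 * alpha * beta * (1 - expR (k * x) ^+ 2)).
  by rewrite mulr_ge0 ?subr_ge0 // !mulr_ge0.
by ring.
Qed.

End Profile.

Section Growth.
Variables (R : realType) (n m : nat) (G : graph n m).
Variables (dV : 'I_n -> nat) (dE : 'I_m -> nat).
Variable S : forall v, {vspace 'cV[R]_(dV v)}.
Variable I : {set 'I_n * 'I_m}.
Variables alpha beta : R.
Hypotheses (halpha : 0 < alpha) (hbeta : 0 < beta).

Local Notation cochain0 := 'cV[R]_(\sum_(v < n) dV v).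
Local Notation cochain1 := 'cV[R]_(\sum_(e < m) dE e).
Local Notation structure := 'M[R]_(\sum_(e < m) dE e, \sum_(v < n) dV v).
Local Notation CQ := (C0_Q S).
Local Notation velocities := (@structure_velocities R n m dV dE I).

(** A single opinion direction at a, either entirely stubborn or entirely free, so
    that the projection on free opinions only multiplies it by 0 or 1. *)
Lemma unit_cochain_at a : (0 < dV a)%N -> exists X : cochain0,
  [/\ mxdot X X = 1, forall v, a != v -> submxcol X v = 0 &
      exists free : bool, orth_proj CQ X = free%:R *: X /\
        if free then CQ X else C0_S S X].
Proof.
move=> da; have [xi xi1 Sxi] := unit_vector_in_or_orth (S a) da.
exists (concentrated xi); split.
- by rewrite mxdot_concentrated concentrated_in.
- by move=> v; exact: concentrated_out.
case: Sxi => [Sxi|xi_orth]; [exists false|exists true].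
  have SX : C0_S S (concentrated xi).
    move=> v; have [<-|av] := eqVneq a v; first by rewrite concentrated_in.
    by rewrite concentrated_out // mem0v.
  rewrite scale0r; split=> //.
  by apply: (orth_proj_eq0 (C0_Q_linear S)) => y Qy; exact: C0_S_orth SX Qy.
have QX : CQ (concentrated xi).
  move=> v s Sv; have [av|av] := eqVneq a v; last first.
    by rewrite concentrated_out // mxdot0r.
  by move: s Sv; rewrite -av => s Sv; rewrite concentrated_in xi_orth.
by rewrite scale1r (orth_proj_id (C0_Q_linear S)).
Qed.

Lemma is_derive_scale k l (f : R -> R) (t df : R) (A : 'M[R]_(k, l)) :
  is_derive t 1 f df -> is_derive t 1 (fun s => f s *: A) (df *: A).
Proof.
move=> Df; apply/is_derive_mxP => i j.
have -> : (fun s => (f s *: A) i j) = A i j \*: f.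
  by apply/funext => s; rewrite mxE mulrC.
by apply: is_derive_eq (is_deriveZ _ Df) _; rewrite mxE mulrC.
Qed.

Lemma is_derive_within_continuous k l (f df : R -> 'M[R]_(k, l)) (A : set R) :
  (forall t, A t -> is_derive t 1 f (df t)) -> {within A, continuous f}.
Proof.
move=> fd; rewrite continuous_subspace_in => t; rewrite inE => At.
apply: continuous_subspaceT_for => //; apply: differentiable_continuous.
by apply/derivable1_diffP; case: (fd t At).
Qed.

Lemma submxblock_rank1 (Y : cochain1) (X : cochain0) e v :
  submxblock (Y *m X^T) e v = submxcol Y e *m (submxcol X v)^T.
Proof.
apply/matrixP => i j; rewrite !mxE; apply: eq_bigr => k _.
by rewrite !mxE.
Qed.

Section OneEdge.
Variables (e : 'I_m) (a b : 'I_n) (Xa Xb : cochain0) (Y : cochain1).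
Hypotheses (ab : a != b) (Iae : (a, e) \in I) (Ibe : (b, e) \notin I).
Hypotheses (inc_a : incident G a e) (inc_b : incident G b e).
Hypotheses (Xa1 : mxdot Xa Xa = 1) (Xb1 : mxdot Xb Xb = 1) (Y1 : mxdot Y Y = 1).
Hypothesis Xa_out : forall v, a != v -> submxcol Xa v = 0.
Hypothesis Xb_out : forall v, b != v -> submxcol Xb v = 0.
Hypothesis Y_out : forall e', e != e' -> submxcol Y e' = 0.
Variables fa fb : bool.
Hypothesis PXa : orth_proj CQ Xa = fa%:R *: Xa.
Hypothesis PXb : orth_proj CQ Xb = fb%:R *: Xb.
Hypothesis XaV : if fa then CQ Xa else C0_S S Xa.
Hypothesis XbV : if fb then CQ Xb else C0_S S Xb.

Let Xab : mxdot Xa Xb = 0.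
Proof.
rewrite mxdot_mxcol big1 // => v _.
have [av|av] := eqVneq a v; last by rewrite Xa_out // mxdot0l.
by rewrite Xb_out ?mxdot0r // eq_sym -av.
Qed.

Let YXa_velocity : velocities (Y *m Xa^T).
Proof.
move=> e' v Ive; rewrite submxblock_rank1.
have [ee|ee] := eqVneq e e'; last by rewrite Y_out // mul0mx.
have [av|av] := eqVneq a v; last by rewrite Xa_out // trmx0 mulmx0.
by move: Ive; rewrite -ee -av Iae.
Qed.

Let YXb_orth B : velocities B -> mxdot (Y *m Xb^T) B = 0.
Proof.
move=> VB; rewrite mxdot_mxblock big1 // => e' _; rewrite big1 // => v _.
rewrite submxblock_rank1.
have [ee|ee] := eqVneq e e'; last by rewrite Y_out // mul0mx mxdot0l.
have [bv|bv] := eqVneq b v; last by rewrite Xb_out // trmx0 mulmx0 mxdot0l.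
by rewrite VB ?mxdot0r // -ee -bv.
Qed.

Let YX_coboundary c (X : cochain0) :
  incident G c e -> (forall v, c != v -> submxcol X v = 0) ->
  is_coboundary G (Y *m X^T).
Proof.
move=> inc_c X_out; apply/is_coboundaryP => e' v; rewrite submxblock_rank1.
have [<-|ee] := eqVneq e e'; last by rewrite Y_out // mul0mx.
have [<-|cv] := eqVneq c v; last by rewrite X_out // trmx0 mulmx0.
by rewrite inc_c.
Qed.

Let delta (p : R) : structure := p *: (Y *m Xa^T) + Y *m Xb^T.

Let delta_coboundary p : is_coboundary G (delta p).
Proof.
have [_ linB] := @is_coboundary_linear R n m G dV dE.
by apply: linB; [exact: YX_coboundary inc_a Xa_out|exact: YX_coboundary inc_b Xb_out].
Qed.

Let frobenius_delta p : mxdot (delta p) (delta p) = p ^+ 2 + 1.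
Proof.
rewrite /delta !mxdotDl !mxdotDr !mxdotZl !mxdotZr !mxdot_rank1 Y1 Xa1 Xb1.
by rewrite (mxdotC Xb) Xab; ring.
Qed.

(** Both gradients stay in the plane of the ansatz and are multiples of the
    disagreement w on the edge; the incidence of b being fixed, the structure
    gradient only moves the coefficient p. *)
Let velocitiesE s p r :
  let x := s *: Xa + r *: Xb in let w := p * s + r in
  orth_proj CQ ((delta p)^T *m delta p *m x) =
    (w * (p * fa%:R)) *: Xa + (w * fb%:R) *: Xb /\
  orth_proj velocities (delta p *m x *m x^T) = (w * s) *: (Y *m Xa^T).
Proof.
move=> x w.
have dotmx (X Z : cochain0) : Y *m X^T *m Z = mxdot X Z *: Y.
  by rewrite -mulmxA mulmx_dot mul_mx_scalar.
have dx : delta p *m x = w *: Y.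
  rewrite /delta /x mulmxDl -scalemxAl !mulmxDr -!scalemxAr !dotmx.
  rewrite Xa1 Xab (mxdotC Xb) Xab Xb1 !scale0r !scaler0 addr0 add0r !scale1r.
  by rewrite scalerA -scalerDl.
have linQ := @C0_Q_linear R n dV S.
have linM := @structure_velocities_linear R n m dV dE I.
split.
  have dY : (delta p)^T *m Y = p *: Xa + Xb.
    rewrite /delta linearD linearZ /= !trmx_mul !trmxK mulmxDl -scalemxAl.
    by rewrite -!mulmxA mulmx_dot Y1 !mulmx1.
  rewrite -mulmxA dx -scalemxAr dY scalerDr scalerA.
  rewrite (orth_projD linQ) !(orth_projZ linQ) PXa PXb !scalerA.
  by rewrite mulrA.
rewrite dx linearD !linearZ /= mulmxDr -!scalemxAr -!scalemxAl !scalerA.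
rewrite (orth_projD linM) !(orth_projZ linM) (orth_proj_id linM YXa_velocity).
by rewrite (orth_proj_eq0 linM YXb_orth) scaler0 addr0 mulrC.
Qed.

Lemma one_edge_growth : exists u y d,
  [/\ C0_S S u, solution G S I alpha beta u y d &
      frobenius_norm (d 0 : structure) < frobenius_norm (d 1)].
Proof.
have [s [p [L [Ds Dp s0 [p0 s1] sL]]]] := growth_profile halpha hbeta fa fb.
(* The constant makes the disagreement w vanish at parameter 0. *)
pose r (x : R) := fb%:R * alpha * x - p 0 * s 0.
have Dr (x : R) : is_derive x 1 r (fb%:R * alpha).
  have -> : r = (fb%:R * alpha) \*: id - cst (p 0 * s 0) by [].
  by apply: is_derive_eq; rewrite subr0 /GRing.scale /= mulr1.
pose w (x : R) := p x * s x + r x.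
pose dw x := beta * s x ^+ 2 + fa%:R * alpha * p x ^+ 2 + fb%:R * alpha.
have Dw (x : R) : is_derive x 1 w (dw x).
  have Dsx := Ds x; have Dpx := Dp x; have Drx := Dr x.
  have -> : w = p * s + r by [].
  by apply: is_derive_eq; rewrite /GRing.scale /= /dw; ring.
have w0 : w 0 = 0 by rewrite /w /r mulr0 sub0r subrr.
have dw_gt0 x : x <= 0 -> 0 < dw x.
  move=> _; rewrite /dw -addrA ltr_wpDr ?mulr_gt0 ?exprn_gt0 //.
  have a0 := ltW halpha.
  by rewrite addr_ge0 // mulr_ge0 ?sqr_ge0 // mulr_ge0.
have [theta [th0 th_lt0 th_gt Dth]] := scalar_flow Dw w0 dw_gt0 sL.
have Dcomp (f df : R -> R) (t : R) : 0 <= t ->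
    (forall x : R, is_derive x 1 f (df x)) ->
    is_derive t 1 (f \o theta) (df (theta t) * - w (theta t)).
  by move=> t0 Df; exact: is_derive1_comp (Df (theta t)) (Dth t t0).
(* The components of x along stubborn directions are constant: s is then 1, and r
   is r 0. *)
pose u : cochain0 := (~~ fa)%:R *: Xa + ((~~ fb)%:R * r 0) *: Xb.
pose y t : cochain0 :=
  (fa%:R * s (theta t)) *: Xa + (fb%:R * r (theta t)) *: Xb.
pose d t := delta (p (theta t)).
have uyE t : u + y t = s (theta t) *: Xa + r (theta t) *: Xb.
  rewrite /u /y addrACA -!scalerDl; congr (_ *: _ + _ *: _).
    by case: (fa) s1 => [_|->] //=; rewrite ?mul0r ?mul1r ?add0r ?addr0.
  by rewrite /r; case: (fb); rewrite /= !(mul0r, mul1r, add0r, addr0).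
have vE t := velocitiesE (s (theta t)) (p (theta t)) (r (theta t)).
have Dy (t : R) : 0 <= t ->
    is_derive t 1 y (opinion_velocity S alpha u (y t) (d t)).
  move=> t0; rewrite /opinion_velocity uyE (vE t).1 -/(w _).
  have DA := is_derive_scale (fa%:R *: Xa) (Dcomp _ _ _ t0 Ds).
  have DB := is_derive_scale (fb%:R *: Xb) (Dcomp _ _ _ t0 Dr).
  have -> : y = (fun t => (s \o theta) t *: (fa%:R *: Xa)) +
                (fun t => (r \o theta) t *: (fb%:R *: Xb)).
    by apply/funext => z; rewrite /y fctE !scalerA ![_ * _%:R]mulrC.
  apply: is_derive_eq (is_deriveD DA DB) _.
  rewrite scalerDr !scalerA; congr (_ *: _ + _ *: _).
    by case: (fa); rewrite /=; ring.
  by case: (fb); rewrite /=; ring.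
have Dd (t : R) : 0 <= t ->
    is_derive t 1 d (structure_velocity I beta u (y t) (d t)).
  move=> t0; rewrite /structure_velocity uyE (vE t).2 -/(w _).
  have DA := is_derive_scale (Y *m Xa^T) (Dcomp _ _ _ t0 Dp).
  have -> : d = (fun t => (p \o theta) t *: (Y *m Xa^T)) + cst (Y *m Xb^T) by [].
  apply: is_derive_eq (is_deriveD DA (is_derive_cst _ _ _)) _.
  by rewrite addr0 scalerA; congr (_ *: _); ring.
exists u, y, d; split.
- have linS := C0_S_linear S.
  apply: (linear_setD linS).
    case: (fa) XaV => /= [_|Sa]; first by rewrite scale0r; case: linS.
    by rewrite scale1r.
  case: (fb) XbV => /= [_|Sb]; last exact: (linear_setZ linS).
  by rewrite mul0r scale0r; case: linS.
- split.
  + move=> t _; have linQ := C0_Q_linear S; apply: (linear_setD linQ).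
      case: (fa) XaV => /= [Qa|_]; first exact: (linear_setZ linQ).
      by rewrite mul0r scale0r; case: linQ.
    case: (fb) XbV => /= [Qb|_]; first exact: (linear_setZ linQ).
    by rewrite mul0r scale0r; case: linQ.
  + by move=> t _; exact: delta_coboundary.
  + apply: (is_derive_within_continuous
      (df := fun t => opinion_velocity S alpha u (y t) (d t))) => t.
    by rewrite /= in_itv /= andbT; exact: Dy.
  + apply: (is_derive_within_continuous
      (df := fun t => structure_velocity I beta u (y t) (d t))) => t.
    by rewrite /= in_itv /= andbT; exact: Dd.
  + by move=> t /ltW; exact: Dy.
  + by move=> t /ltW; exact: Dd.
have p_lt : p (theta 0) < p (theta 1).
  rewrite th0 -subr_gt0; have th1 := th_gt 1 ltr01.
  have [|c _ ->] := MVT th1 (fun x _ => Dp x).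
    apply: continuous_subspaceT => z; apply: differentiable_continuous.
    by apply/derivable1_diffP; case: (Dp z).
  by rewrite !mulr_gt0 ?subr_gt0.
rewrite /d /frobenius_norm !frobenius_delta ltr_sqrt; last first.
  by rewrite ltr_wpDl ?sqr_ge0.
have pm1 : 0 <= p (theta 0) by rewrite p0 // th0.
by rewrite ltrD2r ltr_sqr // nnegrE // (le_trans pm1) // ltW.
Qed.

End OneEdge.

Lemma type_A_growth e : e \in type_A G I ->
  [/\ (0 < dV (src G e))%N, (0 < dV (tgt G e))%N & (0 < dE e)%N] ->
  exists u y d, [/\ C0_S S u, solution G S I alpha beta u y d &
      frobenius_norm (d 0 : structure) < frobenius_norm (d 1)].
Proof.
rewrite inE => Ae [ds dt de].
have [eta eta1 _] := unit_vector_in_or_orth (0%VS : {vspace 'cV[R]_(dE e)}) de.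
have Y1 : mxdot (concentrated eta) (concentrated eta) = 1.
  by rewrite mxdot_concentrated concentrated_in.
have Yo := concentrated_out eta.
have [Xs [Xs1 Xso [fs [PXs XsV]]]] := unit_cochain_at ds.
have [Xt [Xt1 Xto [ft [PXt XtV]]]] := unit_cochain_at dt.
have st := loopless G e.
have inc_s : incident G (src G e) e by rewrite /incident eqxx.
have inc_t : incident G (tgt G e) e by rewrite /incident eqxx orbT.
case: (boolP ((src G e, e) \in I)) Ae => Is /= It.
  exact: (one_edge_growth st Is It inc_s inc_t Xs1 Xt1 Y1 Xso Xto Yo
    PXs PXt XsV XtV).
rewrite eq_sym in st.
exact: (one_edge_growth st It Is inc_t inc_s Xt1 Xs1 Y1 Xto Xso Yo
  PXt PXs XtV XsV).
Qed.

End Growth.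

(** * Convergence of precompact trajectories *)

Section Convergence.
Variables (R : realType) (n m : nat) (G : graph n m).
Variables (dV : 'I_n -> nat) (dE : 'I_m -> nat).
Variable S : forall v, {vspace 'cV[R]_(dV v)}.
Variable I : {set 'I_n * 'I_m}.
Variables alpha beta : R.
Hypotheses (halpha : 0 < alpha) (hbeta : 0 < beta).

Local Notation cochain0 := 'cV[R]_(\sum_(v < n) dV v).
Local Notation structure := 'M[R]_(\sum_(e < m) dE e, \sum_(v < n) dV v).
Local Notation state := (cochain0 * structure)%type.

Variable u : cochain0.

Lemma cvg_opinion_gradient (p : state) :
  orth_proj (C0_Q S) (z.2^T *m z.2 *m (u + z.1)) @[z --> p] -->
  orth_proj (C0_Q S) (p.2^T *m p.2 *m (u + p.1)).
Proof.
have FF : Filter (nbhs p) := nbhs_filter p.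
have c1 : z.1 @[z --> p] --> p.1 by exact: cvg_fst.
have c2 : z.2 @[z --> p] --> p.2 by exact: cvg_snd.
have cx : u + z.1 @[z --> p] --> u + p.1 by apply: cvgD => //; exact: cvg_cst.
apply: cvg_comp (cvg_mulmx FF (cvg_mulmx FF (cvg_trmx FF c2) c2) cx) _.
exact/linear_mx_continuous/orth_proj_linear/C0_Q_linear.
Qed.

Lemma cvg_structure_gradient (p : state) :
  orth_proj (structure_velocities I) (z.2 *m (u + z.1) *m (u + z.1)^T)
    @[z --> p] -->
  orth_proj (structure_velocities I) (p.2 *m (u + p.1) *m (u + p.1)^T).
Proof.
have FF : Filter (nbhs p) := nbhs_filter p.
have c1 : z.1 @[z --> p] --> p.1 by exact: cvg_fst.
have c2 : z.2 @[z --> p] --> p.2 by exact: cvg_snd.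
have cx : u + z.1 @[z --> p] --> u + p.1 by apply: cvgD => //; exact: cvg_cst.
apply: cvg_comp (cvg_mulmx FF (cvg_mulmx FF c2 cx) (cvg_trmx FF cx)) _.
exact/linear_mx_continuous/orth_proj_linear/structure_velocities_linear.
Qed.

Lemma dissipation_continuous :
  continuous (fun z : state => dissipation S I alpha beta u z.1 z.2).
Proof.
move=> p; have FF : Filter (nbhs p) := nbhs_filter p.
have cg := @cvg_opinion_gradient p; have ch := @cvg_structure_gradient p.
exact: (@cvgD _ _ _ (nbhs p) FF _ _ _ _
  (@cvgMl_tmp _ _ _ FF _ _ _ (cvg_mxdot FF cg cg))
  (@cvgMl_tmp _ _ _ FF _ _ _ (cvg_mxdot FF ch ch))).
Qed.

Lemma compact_norm_bound (T : topologicalType) (V : normedModType R)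
    (K : set T) (f : T -> V) : compact K -> continuous f ->
  exists2 M, 0 < M & forall x, K x -> `|f x| <= M.
Proof.
move=> cK cf.
have [M [_ fM]] : bounded_set (f @` K).
  by apply/compact_bounded/continuous_compact => //; exact: continuous_subspaceT.
exists (`|M| + 1); first by rewrite ltr_wpDl.
by move=> x Kx; apply: fM; [rewrite ltr_pwDr // ler_norm|exists x].
Qed.

Section Trajectory.
Variables (y : R -> cochain0) (d : R -> structure).
Hypothesis sol : solution G S I alpha beta u y d.
Hypothesis pc : precompact (forward_orbit y d).

Lemma trajectory_lipschitz : exists2 M, 0 < M &
  forall s t, 0 <= s -> s <= t -> `|(y t, d t) - (y s, d s)| <= M * (t - s).
Proof.
have cK : compact (closure (forward_orbit y d)) by rewrite -precompactE.
have orb t : 0 <= t -> closure (forward_orbit y d) (y t, d t).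
  by move=> t0; apply: subset_closure; exists t => //=; rewrite in_itv /= t0.
have [|M1 M10 yM] := @compact_norm_bound _ _ _
    (fun z : state => opinion_velocity S alpha u z.1 z.2) cK.
  by move=> p; apply: (@cvgZl_tmp _ _ _ _ (nbhs_filter p)); exact: cvg_opinion_gradient.
have [|M2 M20 dM] := @compact_norm_bound _ _ _
    (fun z : state => structure_velocity I beta u z.1 z.2) cK.
  by move=> p; apply: (@cvgZl_tmp _ _ _ _ (nbhs_filter p)); exact: cvg_structure_gradient.
exists (M1 + M2); first exact: addr_gt0.
move=> s t s0 st.
have sub : `[s, t]%classic `<=` `[0, +oo[%classic.
  by move=> x /=; rewrite !in_itv /= andbT => /andP[sx _]; exact: le_trans sx.
have pos x : x \in `]s, t[ -> 0 < x.
  by rewrite in_itv /= => /andP[sx _]; exact: le_lt_trans sx.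
have nng x : x \in `[s, t] -> 0 <= x.
  by rewrite in_itv /= => /andP[sx _]; exact: le_trans sx.
have ts0 : 0 <= t - s by rewrite subr_ge0.
have := @mx_increment_le R _ _ y (fun x => opinion_velocity S alpha u (y x) (d x))
  M1 s t st (fun x xs => sol_opinion_ode sol (pos x xs))
  (continuous_subspaceW sub (sol_opinion_cont sol))
  (fun x xs => yM _ (orb x (nng x xs))).
have := @mx_increment_le R _ _ d (fun x => structure_velocity I beta u (y x) (d x))
  M2 s t st (fun x xs => sol_structure_ode sol (pos x xs))
  (continuous_subspaceW sub (sol_structure_cont sol))
  (fun x xs => dM _ (orb x (nng x xs))).
move=> dle yle; rewrite prod_normE /= ge_max.
rewrite (le_trans yle) ?(le_trans dle) // ler_wpM2r // ?lerDl ?lerDr ltW //.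
Qed.

(** Otherwise the dissipation exceeds c / 2 on a ball of radius r around p.  From
    within r / 2 of p the trajectory, of speed at most M, needs the time h to
    leave this ball, so that each visit costs h c / 2 of energy; but after a time
    T when the energy is within h c / 2 of its infimum there is not that much
    left. *)
Lemma recurrent_dissipation_eq0 (p : state) :
  (forall r T : R, 0 < r -> exists t, [/\ 0 <= t, T <= t & `|(y t, d t) - p| < r]) ->
  dissipation S I alpha beta u p.1 p.2 = 0.
Proof.
move=> rec; apply/eqP; rewrite eq_le dissipation_ge0 // andbT leNgt.
apply/negP => c0; set c := dissipation _ _ _ _ _ _ _ in c0.
pose Psi t := disagreement u (y t) (d t).
have [M M0 lip] := trajectory_lipschitz.
have [r /= r0 Dr] : exists2 r, 0 < r & forall z : state, `|z - p| < r ->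
    c / 2 < dissipation S I alpha beta u z.1 z.2.
  have c20 : 0 < c / 2 by rewrite divr_gt0.
  have [r r0 Dr] := (@nbhs_normP R state p _).1
    ((cvgrPdist_lt _ _).1 (dissipation_continuous (x := p)) _ c20).
  exists r; first exact: r0.
  move=> z zr; have /Dr : ball_ Num.Def.normr p r z by rewrite /ball_ /= distrC.
  by rewrite -/c ltr_norml => /andP[_]; rewrite ltrBlDr {1}(splitr c) ltrD2l.
pose h := r / (2 * M).
have h0 : 0 < h by rewrite divr_gt0 // mulr_gt0.
have Mh : M * h = r / 2 by rewrite /h; field; rewrite gt_eqF.
have hc0 : 0 < h * (c / 2) by rewrite mulr_gt0 // divr_gt0.
have drop t : 0 <= t -> `|(y t, d t) - p| < r / 2 ->
    Psi (t + h) <= Psi t - h * (c / 2).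
  move=> t0 tp.
  have tth : t < t + h by rewrite ltrDl.
  have [x /itvP xt||x /itvP xt PE] := @MVT _ Psi
      (fun s => - dissipation S I alpha beta u (y s) (d s)) t (t + h) tth.
  - by apply: disagreement_derive sol _ _; rewrite (le_lt_trans t0) // xt.
  - apply: continuous_subspaceW (disagreement_continuous sol) => x /=.
    by rewrite !in_itv /= andbT => /andP[tx _]; exact: le_trans tx.
  have xp : `|(y x, d x) - p| < r.
    rewrite -(subrK (y t, d t) (y x, d x)) -addrA (splitr r).
    rewrite (le_lt_trans (ler_normD _ _)) // ler_ltD //.
    rewrite (le_trans (lip _ _ t0 _)) ?xt // -Mh ler_wpM2l ?(ltW M0) //.
    by rewrite lerBlDl xt.
  rewrite -lerBlDl PE addrAC subrr add0r mulNr lerN2 [leRHS]mulrC.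
  apply: ler_wpM2l; first exact: ltW.
  exact: ltW (Dr (y x, d x) xp).
pose E := [set Psi t | t in [set t | 0 <= t]].
have infE : has_inf E.
  split; first by exists (Psi 0), 0 => //=.
  by exists 0 => _ [t _ <-]; exact: disagreement_ge0.
have [_ [T T0 <-] PT] := inf_adherent hc0 infE.
have [|t [t0 Tt tp]] := rec (r / 2) T; first by rewrite divr_gt0.
have : inf E <= Psi (t + h).
  by apply: ge_inf; [exact: infE.2|exists (t + h) => //=; rewrite addr_ge0 // ltW].
have := drop t t0 tp.
have : Psi t <= Psi T by exact: (disagreement_nonincreasing halpha hbeta sol).
lra.
Qed.

(** If the trajectory were at distance at least eps from the equilibria at
    arbitrarily large times, its values at these times would cluster at some point
    p of the closure of the orbit.  The dissipation vanishes at p and the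
    constraints are closed, so that p is an equilibrium, approached closer than
    eps. *)
Lemma precompact_converges :
  converges_to_set y d (equilibria G S I alpha beta u).
Proof.
move=> eps eps0; apply: contrapT => notnear.
pose bad t := ~ exists2 p, equilibria G S I alpha beta u p &
  `|(y t, d t) - p| < eps.
pose F := within bad (pinfty_nbhs R).
have PF : ProperFilter F.
  split; last exact: within_filter.
  move=> F0; apply: notnear.
  have {}F0 : \forall t \near +oo, bad t -> False := F0.
  apply: filterS F0 => t bt.
  by apply: contrapT; exact: bt.
pose z t : state := (y t, d t).
have FT T : F [set t | [/\ 0 <= t, T <= t & bad t]].
  have : \forall t \near +oo, 0 <= t /\ T <= t :> R.
    by near=> t; split; near: t; apply: nbhs_pinfty_ge; rewrite num_real.
  by apply: filterS => t [t0 Tt] bt; split.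
have cK : compact (closure (forward_orbit y d)) by rewrite -precompactE.
have [|p [Kp clp]] := cK (z @ F) _.
  apply: filterS (FT 0) => t [t0 _ _]; apply: subset_closure.
  by exists t => //=; rewrite in_itv /= t0.
have rec (r T : R) : 0 < r ->
    exists t, [/\ 0 <= t, T <= t, bad t & `|z t - p| < r].
  move=> r0.
  have [||x [[t [t0 Tt bt] <-] /= tp]] := clp (z @` [set t | [/\ 0 <= t, T <= t & bad t]])
      [set x | `|x - p| < r].
  - by apply: filterS (FT T) => t tP; exists t.
  - apply: (@nbhs_normP R state p _).2; exists r; first exact: r0.
    by move=> x; rewrite /ball_ /= distrC.
  by exists t.
have Dp : dissipation S I alpha beta u p.1 p.2 = 0.
  apply: recurrent_dissipation_eq0 => r T r0.
  by have [t [t0 Tt _ tp]] := rec r T r0; exists t.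
have [op0 st0] := dissipation_eq0 halpha hbeta Dp.
have closedQ : closed [set x : state | C0_Q S x.1].
  apply: (@preimage_closed state cochain0 fst (C0_Q S)).
    by move=> x _; exact: cvg_fst.
  exact: (linear_set_closed (C0_Q_linear S)).
have closedB : closed [set x : state | is_coboundary G x.2].
  apply: (@preimage_closed state structure snd [set D | is_coboundary G D]).
    by move=> x _; exact: cvg_snd.
  exact: (linear_set_closed (@is_coboundary_linear R n m G dV dE)).
have [t [_ _ bt tp]] := rec eps 0 eps0.
apply: bt; exists p => //; split=> //.
- apply: (closedQ p); apply: closure_subset Kp => _ [t' t0 <-] /=.
  by apply: (sol_opinion_space sol); move: t0; rewrite /= in_itv /= andbT.
- apply: (closedB p); apply: closure_subset Kp => _ [t' t0 <-] /=.
  by apply: (sol_structure_space sol); move: t0; rewrite /= in_itv /= andbT.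
Unshelve. all: by end_near. Qed.

End Trajectory.
End Convergence.

(** * The theorem *)

Lemma type_A_notin_type_S n m (G : graph n m) (I : {set 'I_n * 'I_m}) e :
  (e \in type_A G I) = (e \notin type_S G I).
Proof. by rewrite !inE; do 2 case: (_ \in I). Qed.

Theorem theorem5p2 (R : realType) (n m : nat) (G : graph n m)
    (dV : 'I_n -> nat) (dE : 'I_m -> nat)
    (U : {set 'I_n}) (S : forall v, {vspace 'cV[R]_(dV v)})
    (hS : forall v, v \notin U -> S v = 0%VS)
    (I : {set 'I_n * 'I_m}) (hI : I \subset incidences G)
    (alpha beta : R) (halpha : 0 < alpha) (hbeta : 0 < beta) :
  [/\ (forall (u : 'cV[R]_(\sum_(v < n) dV v))
              (y : R -> 'cV[R]_(\sum_(v < n) dV v))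
              (d : R -> 'M[R]_(\sum_(e < m) dE e, \sum_(v < n) dV v)),
          C0_S S u -> solution G S I alpha beta u y d ->
          nonincreasing_nonneg (fun t => disagreement u (y t) (d t))),
      ((forall e, e \in type_A G I ->
          [/\ (0 < dV (src G e))%N, (0 < dV (tgt G e))%N & (0 < dE e)%N]) ->
       ((forall (u : 'cV[R]_(\sum_(v < n) dV v))
                (y : R -> 'cV[R]_(\sum_(v < n) dV v))
                (d : R -> 'M[R]_(\sum_(e < m) dE e, \sum_(v < n) dV v)),
            C0_S S u -> solution G S I alpha beta u y d ->
            nonincreasing_nonneg (fun t => frobenius_norm (d t)))
        <-> (forall e, e \in type_S G I))),
      ((forall e, e \in type_S G I) <-> type_A G I = finset.set0)
    & (forall (u : 'cV[R]_(\sum_(v < n) dV v))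
              (y : R -> 'cV[R]_(\sum_(v < n) dV v))
              (d : R -> 'M[R]_(\sum_(e < m) dE e, \sum_(v < n) dV v)),
          C0_S S u -> solution G S I alpha beta u y d ->
          precompact (forward_orbit y d) ->
          converges_to_set y d (equilibria G S I alpha beta u))].
Proof.
split.
- by move=> u y d _ sol; exact: (disagreement_nonincreasing halpha hbeta sol).
- move=> dims; split=> [mono e|allS u y d _ sol]; last first.
    exact: (frobenius_norm_nonincreasing hI hbeta sol allS).
  rewrite -[_ \in _]negbK -type_A_notin_type_S; apply/negP => Ae.
  have [u [y [d [Su sol lt01]]]] := type_A_growth S halpha hbeta Ae (dims e Ae).
  by have := mono u y d Su sol 0 1 (lexx 0) ler01; rewrite leNgt lt01.
- split=> [allS|A0 e].
    by apply/setP => e; rewrite type_A_notin_type_S allS inE.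
  by rewrite -[_ \in _]negbK -type_A_notin_type_S A0 inE.
- by move=> u y d _ sol pc; exact: (precompact_converges halpha hbeta sol pc).
Qed.
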